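(* Let $\mathfrak{H}$ be a separable Hilbert space with an orthogonal decomposition $\mathfrak{H}=\mathfrak{H}_0\oplus\mathfrak{H}_1$, let $A_0$, $A_1$ be bounded self-adjoint operators on $\mathfrak{H}_0$, $\mathfrak{H}_1$ respectively, let $V:\mathfrak{H}_1\to\mathfrak{H}_0$ be a bounded operator, and let $\lambda\in\mathbb{R}$ satisfy $\sup\mathrm{spec}(A_0)\le\lambda\le\inf\mathrm{spec}(A_1)$. Put $$\mathbf{B}=\begin{pmatrix}A_0&V\\ V^*&A_1\end{pmatrix},\qquad \mathfrak{Q}=\mathrm{Ran}\,\mathsf{E}_{\mathbf{B}}((-\infty,\lambda))\oplus\big(\mathrm{Ran}\,\mathsf{E}_{\mathbf{B}}(\{\lambda\})\cap\mathfrak{H}_0\big),$$ and let $X:\mathfrak{H}_0\to\mathfrak{H}_1$ be the contractive solution to the Riccati equation $$A_1X-XA_0-XVX+V^*=0$$ with $\mathcal{G}(\mathfrak{H}_0,X)=\mathfrak{Q}$. Then $X$ is an isolated point (in the operator norm topology) of the set of all solutions to the Riccati equation if and only if either $\mathrm{Ker}(A_0-\lambda)\cap\mathrm{Ker}\,V^*=\{0\}$ or $\mathrm{Ker}(A_1-\lambda)\cap\mathrm{Ker}\,V=\{0\}$.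
   Context: $\mathrm{spec}(T)$ denotes the spectrum of $T$, and $\mathsf{E}_{\mathbf{B}}(\Delta)$ the spectral projection of the self-adjoint operator $\mathbf{B}$ for the Borel set $\Delta\subset\mathbb{R}$. The graph of $X$ is $\mathcal{G}(\mathfrak{H}_0,X)=\{x\oplus Xx\mid x\in\mathfrak{H}_0\}$. Under the stated hypotheses it is known that $\mathfrak{Q}$ is the graph of a (necessarily unique) operator $X$ with $\|X\|\le1$ and that this $X$ solves the Riccati equation. Solutions here are bounded operators $\mathfrak{H}_0\to\mathfrak{H}_1$ satisfying the Riccati equation. *)

(* Defs.v *)
From HB Require Import structures.
From mathcomp Require Import all_boot all_order all_algebra.
From mathcomp Require Import complex ring.
From mathcomp Require Import all_classical all_reals all_analysis.

Set Implicit Arguments.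
Unset Strict Implicit.
Unset Printing Implicit Defensive.

Import Order.TTheory GRing.Theory Num.Theory.
Import numFieldNormedType.Exports.

Local Open Scope classical_set_scope.
Local Open Scope ring_scope.
Local Open Scope complex_scope.

HB.mixin Record NormedModule_isHilbert (R : realType) H
    & CompleteNormedModule R[i] H := {
  inner : {dot H for Num.conj} ;
  inner_normE : forall x : H, inner x x = `|x| ^+ 2
}.

#[short(type="hilbertType")]
HB.structure Definition Hilbert (R : realType) :=
  {H of CompleteNormedModule R[i] H & NormedModule_isHilbert R H}.

Notation "''[' u , v ]" := (inner u v) : ring_scope.

Definition separable_space (T : topologicalType) :=
  exists D : set T, countable D /\ dense D.

(* The product type carries the sup norm in the library, hence an alias for
   the orthogonal direct sum. *)
Definition hsum (R : realType) (H0 H1 : hilbertType R) : Type :=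
  (H0 * H1)%type.

Section hsum_instances.
Context {R : realType} (H0 H1 : hilbertType R).
Implicit Types u v w : hsum H0 H1.

HB.instance Definition _ := GRing.Lmodule.copy (hsum H0 H1) (H0 * H1)%type.

Definition hsum_norm u : R[i] := sqrtC (`|u.1| ^+ 2 + `|u.2| ^+ 2).

Lemma sqr_hsum_norm u : hsum_norm u ^+ 2 = `|u.1| ^+ 2 + `|u.2| ^+ 2.
Proof. exact: sqrtCK. Qed.

Lemma hsum_norm_ge0 u : 0 <= hsum_norm u.
Proof. by rewrite sqrtC_ge0 addr_ge0// exprn_ge0. Qed.

Lemma hsum_normD u v : hsum_norm (u + v) <= hsum_norm u + hsum_norm v.
Proof.
have C0 : 0 <= `|u.1| * `|v.1| + `|u.2| * `|v.2|.
  by rewrite addr_ge0// mulr_ge0.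
have CS : `|u.1| * `|v.1| + `|u.2| * `|v.2| <= hsum_norm u * hsum_norm v.
  rewrite -ler_sqr ?nnegrE ?mulr_ge0 ?hsum_norm_ge0// exprMn !sqr_hsum_norm.
  rewrite -subr_ge0.
  have -> : (`|u.1| ^+ 2 + `|u.2| ^+ 2) * (`|v.1| ^+ 2 + `|v.2| ^+ 2)
    - (`|u.1| * `|v.1| + `|u.2| * `|v.2|) ^+ 2
    = (`|u.1| * `|v.2| - `|u.2| * `|v.1|) ^+ 2 by ring.
  by rewrite real_exprn_even_ge0// rpredB// rpredM// normr_real.
rewrite -ler_sqr ?nnegrE ?addr_ge0 ?hsum_norm_ge0// sqrrD !sqr_hsum_norm.
have le1 : `|(u + v).1| ^+ 2 <= (`|u.1| + `|v.1|) ^+ 2.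
  by rewrite ler_sqr ?nnegrE ?addr_ge0// ler_normD.
have le2 : `|(u + v).2| ^+ 2 <= (`|u.2| + `|v.2|) ^+ 2.
  by rewrite ler_sqr ?nnegrE ?addr_ge0// ler_normD.
apply: (le_trans (lerD le1 le2)).
have -> : (`|u.1| + `|v.1|) ^+ 2 + (`|u.2| + `|v.2|) ^+ 2 =
   `|u.1| ^+ 2 + `|u.2| ^+ 2 + (`|u.1| * `|v.1| + `|u.2| * `|v.2|) *+ 2
   + (`|v.1| ^+ 2 + `|v.2| ^+ 2) by ring.
by rewrite lerD2r lerD2l ler_pMn2r.
Qed.

Lemma hsum_normZ (a : R[i]) u : hsum_norm (a *: u) = `|a| * hsum_norm u.
Proof.
apply: (pexpIrn (n := 2)) => //.
- by rewrite nnegrE hsum_norm_ge0.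
- by rewrite nnegrE mulr_ge0// hsum_norm_ge0.
by rewrite exprMn !sqr_hsum_norm /= !normrZ !exprMn mulrDr.
Qed.

Lemma hsum_norm_eq0 u : hsum_norm u = 0 -> u = 0.
Proof.
case: u => x y /eqP; rewrite sqrtC_eq0 paddr_eq0 ?exprn_ge0//=.
by rewrite !sqrf_eq0 !normr_eq0 => /andP[/eqP-> /eqP->].
Qed.

HB.instance Definition _ := Lmodule_isNormed.Build R[i] (hsum H0 H1)
  hsum_normD hsum_normZ hsum_norm_eq0.

Lemma norm_fst_le u : `|u.1| <= `|u|.
Proof.
rewrite -ler_sqr ?nnegrE// sqr_hsum_norm lerDl.
by rewrite exprn_ge0.
Qed.

Lemma norm_snd_le u : `|u.2| <= `|u|.
Proof.
rewrite -ler_sqr ?nnegrE// sqr_hsum_norm lerDr.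
by rewrite exprn_ge0.
Qed.

Lemma norm_hsum_le u : `|u| <= `|u.1| + `|u.2|.
Proof.
rewrite -ler_sqr ?nnegrE ?addr_ge0// sqr_hsum_norm sqrrD.
by rewrite lerD2r lerDl mulrn_wge0// mulr_ge0.
Qed.

Let cvg_lip (V : completeNormedModType R[i]) (f : hsum H0 H1 -> V)
    (F : set_system (hsum H0 H1)) : ProperFilter F -> cauchy F ->
  (forall u v, `|f u - f v| <= `|u - v|) -> cvg (f @ F).
Proof.
move=> FF /cauchy_ballP Fc fle; apply: cauchy_cvg; apply/cauchy_ballP => e e0.
have [[A B] /= [FA FB] AB] := Fc _ e0.
exists (f @` A, f @` B) => /=.
  by split; [move: FA|move: FB]; apply: filterS => u ?; exists u.
move=> [_ _] /= [[u Au <-] [v Bv <-]].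
have := AB (u, v) (conj Au Bv).
by rewrite /= -!ball_normE /ball_/=; apply: le_lt_trans.
Qed.

Lemma hsum_complete (F : set_system (hsum H0 H1)) :
  ProperFilter F -> cauchy F -> cvg F.
Proof.
move=> FF Fc.
have F1 := cvg_lip FF Fc (fun u v => norm_fst_le (u - v)).
have F2 := cvg_lip FF Fc (fun u v => norm_snd_le (u - v)).
apply/cvg_ex; exists ((lim (fst @ F), lim (snd @ F)) : hsum H0 H1).
apply/cvgrPdist_lt => e e0; near=> u.
apply: (le_lt_trans (norm_hsum_le _)); rewrite /= [ltRHS]splitr ltrD//.
- by near: u; move/cvgrPdist_lt: F1; apply; rewrite divr_gt0.
- by near: u; move/cvgrPdist_lt: F2; apply; rewrite divr_gt0.
Unshelve. all: by end_near. Qed.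

HB.instance Definition _ :=
  Uniform_isComplete.Build (hsum H0 H1) hsum_complete.

Definition hsum_inner u v : R[i] := '[u.1, v.1] + '[u.2, v.2].

Let hsum_inner_bilinear :
  bilinear_for *%R (Num.conj \; *%R) hsum_inner.
Proof.
split=> [w a u v|w a u v]; rewrite /hsum_inner/=.
  by rewrite !linearPl/= mulrDr addrACA.
by rewrite !linearPr/= mulrDr addrACA.
Qed.

HB.instance Definition _ := bilinear_isBilinear.Build R[i]
  (hsum H0 H1) (hsum H0 H1) R[i] *%R (Num.conj \; *%R) hsum_inner
  hsum_inner_bilinear.

Let hsum_inner_herm u v :
  hsum_inner u v = (-1) ^+ false * Num.conj (hsum_inner v u).
Proof.
by rewrite expr0 mul1r /hsum_inner rmorphD/= (hermC _ u.1) (hermC _ u.2)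
  !expr0 !mul1r.
Qed.

HB.instance Definition _ := isHermitianSesquilinear.Build R[i]
  (hsum H0 H1) false Num.conj hsum_inner hsum_inner_herm.

Let hsum_inner_normE u : hsum_inner u u = `|u| ^+ 2.
Proof. by rewrite /hsum_inner !inner_normE sqr_hsum_norm. Qed.

Let hsum_inner_gt0 u : u != 0 -> 0 < hsum_inner u u.
Proof. by move=> u0; rewrite hsum_inner_normE exprn_gt0// normr_gt0. Qed.

HB.instance Definition _ := isDotProduct.Build R[i] (hsum H0 H1)
  hsum_inner hsum_inner_gt0.

HB.instance Definition _ :=
  NormedModule_isHilbert.Build R (hsum H0 H1) hsum_inner_normE.

End hsum_instances.

Definition is_bop (K : numFieldType) (U V : normedModType K) :
    {pred U -> V} :=
  mem [set f : U -> V | linear f /\ continuous f].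

Section bop.
Context {K : numFieldType} (U V : normedModType K).

(* Bounded operators, as continuous linear maps. *)
Record bop := Bop { bop_fun :> U -> V ; bop_funP : bop_fun \in @is_bop K U V }.

HB.instance Definition _ := [isSub for bop_fun].
HB.instance Definition _ := gen_eqMixin bop.
HB.instance Definition _ := [Choice of bop by <:].

Lemma bopP (f : bop) : linear f /\ continuous f.
Proof. by have := bop_funP f; rewrite inE. Qed.

Lemma bop_linear (f : bop) : linear f. Proof. exact: (bopP f).1. Qed.

Lemma bop_continuous (f : bop) : continuous f. Proof. exact: (bopP f).2. Qed.

HB.instance Definition _ (f : bop) :=
  GRing.isLinear.Build K U V *:%R (bop_fun f) (bop_linear f).

Let is_bop_submod : submod_closed (@is_bop K U V).
Proof.
split=> [|a f g]; rewrite !inE /=.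
  by split=> [b x y|x]; [rewrite /= scaler0 addr0|exact: cvg_cst].
move=> [lf cf] [lg cg]; split=> [b x y|x].
  have E z : (a *: f + g) z = a *: f z + g z by [].
  by rewrite !E lf lg !scalerDr !scalerA (mulrC b) addrACA.
by apply: cvgD; [apply: cvgZr; exact: cf|exact: cg].
Qed.

HB.instance Definition _ := GRing.isSubmodClosed.Build K _ (@is_bop K U V)
  is_bop_submod.
HB.instance Definition _ := [SubChoice_isSubLmodule of bop by <:].

End bop.
Arguments Bop {K U V}.

Section operator_norm.
Context {R : realType} (U V : normedModType R[i]).
Implicit Types f g : bop U V.

Definition bop_norm f : R[i] :=
  (sup [set complex.Re `|f x| | x in [set x | `|x| <= 1]])%:C.

Let Re_normr (W : normedModType R[i]) (x : W) : (complex.Re `|x|)%:C = `|x|.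
Proof. by rewrite RRe_real// normr_real. Qed.

Let bop_ub f : has_ubound [set complex.Re `|f x| | x in [set x | `|x| <= 1]].
Proof.
have : bounded_near f (nbhs (0 : U)).
  exact/linear_bounded_continuous/bop_continuous.
move=> /linear_boundedP/pinfty_ex_gt0[M M0 fM].
exists (complex.Re M) => _ [x /= x1 <-].
rewrite -lecR Re_normr RRe_real ?gtr0_real//.
by rewrite (le_trans (fM x))// ler_piMr// ltW.
Qed.

Let bop_norm_ub f x : `|x| <= 1 -> `|f x| <= bop_norm f.
Proof.
by move=> x1; rewrite -Re_normr lecR; apply: ub_le_sup; [exact: bop_ub|exists x].
Qed.

Let le_bop_norm f (M : R[i]) : 0 <= M ->
  (forall x, `|x| <= 1 -> `|f x| <= M) -> bop_norm f <= M.
Proof.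
move=> M0 fM; rewrite -(RRe_real (ger0_real M0)) lecR; apply: ge_sup.
  by exists (complex.Re `|f 0|), 0 => //=; rewrite normr0.
move=> _ [x /= x1 <-]; rewrite -lecR Re_normr (RRe_real (ger0_real M0)).
exact: fM.
Qed.

Let bop_norm_ge0 f : 0 <= bop_norm f.
Proof. by apply: le_trans (bop_norm_ub f (x := 0) _); rewrite ?normr0. Qed.

Let le_bop_normM f x : `|f x| <= bop_norm f * `|x|.
Proof.
have [->|x0] := eqVneq x 0; first by rewrite linear0 !normr0 mulr0.
have nx0 : 0 < `|x| by rewrite normr_gt0.
rewrite -ler_pdivrMr// mulrC.
have /bop_norm_ub : `| `|x|^-1 *: x | <= 1.
  by rewrite normrZ normfV normr_id mulVf// gt_eqF.
by move=> /(_ f); rewrite linearZ/= normrZ normfV normr_id.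
Qed.

Let bop_normD f g : bop_norm (f + g) <= bop_norm f + bop_norm g.
Proof.
apply: le_bop_norm => [|x x1]; first by rewrite addr_ge0.
by rewrite (le_trans (ler_normD _ _))// lerD// bop_norm_ub.
Qed.

Let bop_normZ_le (a : R[i]) f : bop_norm (a *: f) <= `|a| * bop_norm f.
Proof.
apply: le_bop_norm => [|x x1]; first by rewrite mulr_ge0.
by rewrite normrZ ler_wpM2l// bop_norm_ub.
Qed.

Let bop_normZ (a : R[i]) f : bop_norm (a *: f) = `|a| * bop_norm f.
Proof.
apply/eqP; rewrite eq_le bop_normZ_le/=.
have [->|a0] := eqVneq a 0; first by rewrite normr0 mul0r.
rewrite -[in leLHS](scale1r f) -(mulVf a0) -scalerA.
have na0 : 0 < `|a| by rewrite normr_gt0.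
by rewrite mulrC -ler_pdivlMr// mulrC -normfV bop_normZ_le.
Qed.

Let bop_norm_eq0 f : bop_norm f = 0 -> f = 0.
Proof.
move=> f0; apply/val_inj/funext => x /=; apply/eqP.
by rewrite -normr_le0 (le_trans (le_bop_normM f x))// f0 mul0r.
Qed.

HB.instance Definition _ := Lmodule_isNormed.Build R[i] (bop U V)
  bop_normD bop_normZ bop_norm_eq0.

Lemma bop_normE f : `|f| = bop_norm f. Proof. by []. Qed.

Lemma ler_bop_norm f x : `|f x| <= `|f| * `|x|.
Proof. exact: le_bop_normM. Qed.

End operator_norm.

Section operator_algebra.
Context {K : numFieldType}.
Implicit Types U V W : normedModType K.

Lemma is_bop_id U : @idfun U \in @is_bop K U U.
Proof. by rewrite inE; split=> [a x y //|x]; exact: cvg_id. Qed.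

Definition bop_id U : bop U U := Bop idfun (is_bop_id U).

Lemma is_bop_comp U V W (g : bop V W) (f : bop U V) :
  g \o f \in @is_bop K U W.
Proof.
rewrite inE; split=> [a x y|x]; first by rewrite /= !linearP.
by apply: continuous_comp; exact: bop_continuous.
Qed.

Definition bop_comp U V W (g : bop V W) (f : bop U V) : bop U W :=
  Bop (g \o f) (is_bop_comp g f).

Definition ker U V (f : U -> V) : set U := f @^-1` [set 0].

End operator_algebra.
Arguments bop_id {K} U.

Notation "g '\ob' f" := (bop_comp g f)
  (at level 40, left associativity) : ring_scope.

Section operators.
Context {R : realType}.
Implicit Type H : hilbertType R.

Definition is_adjoint (H0 H1 : hilbertType R) (T : bop H0 H1) (S : bop H1 H0) :=
  forall x y, '[T x, y] = '[x, S y].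

Definition selfadjoint H (T : bop H H) := is_adjoint T T.

Definition spectrum H (T : bop H H) : set R[i] :=
  [set z | ~ exists S : bop H H,
     S \ob (T - z *: bop_id H) = bop_id H /\
     (T - z *: bop_id H) \ob S = bop_id H].

Record projection_valued_measure H (E : set R -> bop H H) : Prop := {
  pvm_proj : forall D, measurable D ->
    selfadjoint (E D) /\ E D \ob E D = E D ;
  pvm_set0 : E set0 = 0 ;
  pvm_setT : E setT = bop_id H ;
  pvm_setI : forall D D', measurable D -> measurable D' ->
    E (D `&` D') = E D \ob E D' ;
  pvm_sigma_additive : forall D : (set R)^nat,
    (forall n, measurable (D n)) -> trivIset setT D ->
    forall x, (fun n => \sum_(k < n) E (D k) x) @ \oo
      --> E (\bigcup_n D n) x }.

Definition spectral_distribution H (E : set R -> bop H H) (x : H) :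
    set R -> \bar R :=
  fun D => (complex.Re '[E D x, x])%:E.

(* [E] is the spectral measure of [B], that is, B = \int t dE(t) weakly;
   by polarization the diagonal terms suffice. *)
Definition is_spectral_measure H (B : bop H H) (E : set R -> bop H H) :=
  projection_valued_measure E /\
  forall x, (spectral_distribution E x).-integrable [set: R] EFin /\
    '[B x, x] = (fine (\int[spectral_distribution E x]_t t%:E)%E)%:C.

Section block.
Context (H0 H1 : hilbertType R) (A0 : bop H0 H0) (A1 : bop H1 H1)
  (V : bop H1 H0) (Vs : bop H0 H1).

Definition block_fun (u : hsum H0 H1) : hsum H0 H1 :=
  (A0 u.1 + V u.2, Vs u.1 + A1 u.2).

Lemma is_bop_block : block_fun \in @is_bop _ (hsum H0 H1) (hsum H0 H1).
Proof.
rewrite inE; have lf : linear block_fun.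
  move=> a u v; rewrite /block_fun/= !linearP/=.
  by congr pair; rewrite /= scalerDr addrACA.
split=> //.
pose f : {linear hsum H0 H1 -> hsum H0 H1} :=
  HB.pack block_fun (GRing.isLinear.Build _ _ _ _ _ lf).
apply: (@bounded_linear_continuous _ _ _ f); apply/ex_bound.
exists (`|A0| + `|V| + (`|Vs| + `|A1|)).
apply/(@nbhs_normP _ (hsum H0 H1)); exists 1 => //= u /=; rewrite sub0r normrN => /ltW u1.
have u11 := le_trans (norm_fst_le u) u1.
have u21 := le_trans (norm_snd_le u) u1.
have le1 (W W' : normedModType R[i]) (T : bop W W') x : `|x| <= 1 ->
    `|T x| <= `|T|.
  by move=> x1; rewrite (le_trans (ler_bop_norm T x))// ler_piMr.
apply: (le_trans (norm_hsum_le _)) => /=.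
by rewrite lerD// (le_trans (ler_normD _ _))// lerD// le1.
Qed.

Definition block_op : bop (hsum H0 H1) (hsum H0 H1) :=
  Bop block_fun is_bop_block.

Definition riccati_solutions : set (bop H0 H1) :=
  [set X | A1 \ob X - X \ob A0 - X \ob V \ob X + Vs = 0].

End block.

Definition graph (H0 H1 : hilbertType R) (X : bop H0 H1) : set (hsum H0 H1) :=
  [set ((x, X x) : hsum H0 H1) | x in [set: H0]].

Definition hsum0 (H0 H1 : hilbertType R) : set (hsum H0 H1) :=
  [set ((x, 0) : hsum H0 H1) | x in [set: H0]].

(* The two summands are orthogonal, as ranges of spectral projections of
   disjoint sets. *)
Definition spectral_sum (H0 H1 : hilbertType R)
    (E : set R -> bop (hsum H0 H1) (hsum H0 H1)) (lambda : R) :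
    set (hsum H0 H1) :=
  [set u + v | u in range (E [set t | t < lambda]) &
              v in range (E [set lambda]) `&` @hsum0 H0 H1].

End operators.

(* Main.v *)
From HB Require Import structures.
Require Import Defs.
From mathcomp Require Import all_boot all_order all_algebra.
From mathcomp Require Import complex ring.
From mathcomp Require Import all_classical all_reals all_analysis.

Set Implicit Arguments.
Unset Strict Implicit.
Unset Printing Implicit Defensive.

Import Order.TTheory GRing.Theory Num.Theory.
Import numFieldNormedType.Exports.

Local Open Scope classical_set_scope.
Local Open Scope ring_scope.
Local Open Scope complex_scope.

(** The mechanism is that a solution [Y] of the Riccati equation is the same
    thing as a graph that is invariant under the block operator [B], hence
    under [C = B - lambda].  Let [P] be the orthogonal projection onto the
    complement of the spectral subspace [graph X].  It commutes with [C], and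
    [C] is nonnegative on the range of [P] and nonpositive on the range of
    [1 - P], both of which may contain part of the kernel of [C].  That
    kernel splits along [H0] and [H1] as
    [(ker (A0 - lambda) `&` ker Vs) + (ker (A1 - lambda) `&` ker V)]
    ([ker_block_shift]), because [A0 <= lambda <= A1] as quadratic forms
    ([form_le_sup], [inf_le_form]); its first summand lies in [graph X], its
    second one in the range of [P].

    If both summands contain nonzero vectors [x0] and [y0], then adding to [X]
    any multiple of the rank one operator [x |-> '[x, x0] *: y0] gives another
    solution ([riccati_perturbation]), so [X] is not isolated.

    If one of them is trivial, let [Y] be a solution close to [X].  Every [u]
    in [graph Y] then satisfies [`|P u| <= `|u - P u|].  As [graph Y] is
    invariant under [S = 1 + e C], the same bound holds for all [S ^ n u].
    For small [e > 0], [S] does not decrease norms on the range of [P] and does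
    not increase them on the range of [1 - P].  When [C] is injective on the
    range of [P], [P (S ^ n u)] grows without bound unless [P u = 0]
    ([subset_of_pos_injective]); when [C] is injective on the range of
    [1 - P], the other component tends to [0] while [P (S ^ n u)] does not
    shrink ([subset_of_neg_injective]).  In both cases [P u = 0], so [graph Y]
    is contained in [graph X] and [Y = X].

    From the spectral measure [E] of [B] one needs that [C] commutes with the
    projections [E D] and has the sign of [t - lambda] on the range of [E D].
    Both follow from the integral formula for ['[B x, x]]
    ([spectral_form_split], [spectral_sign_ge0], [spectral_sign_eq0]). *)

(** * Inner products and quadratic forms *)

Section bop_linear.
Context {K : numFieldType} {U W : normedModType K} (f : bop U W).

Lemma bopD x y : f (x + y) = f x + f y. Proof. exact: linearD. Qed.
Lemma bopB x y : f (x - y) = f x - f y. Proof. exact: linearB. Qed.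
Lemma bopZ a x : f (a *: x) = a *: f x. Proof. exact: linearZ_LR. Qed.
Lemma bop0 : f 0 = 0. Proof. exact: linear0. Qed.

End bop_linear.

Lemma bop_ext (K : numFieldType) (U W : normedModType K) (f g : bop U W) :
  (forall x, f x = g x) -> f = g.
Proof. by move=> fg; apply: val_inj; apply: funext. Qed.

Section inner_product.
Context {R : realType} {H : hilbertType R}.
Implicit Types (x y z : H) (a : R[i]).

Lemma inner_conj x y : '[x, y] = '[y, x]^*%R.
Proof. by rewrite (hermC (@inner R H)) expr0 mul1r. Qed.

Lemma innerZl a x y : '[a *: x, y] = a * '[x, y].
Proof. exact: (linearZl_LR (@inner R H)). Qed.

Lemma innerZr a x y : '[x, a *: y] = a^*%R * '[x, y].
Proof. exact: (linearZr_LR (@inner R H)). Qed.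

Lemma innerDl x y z : '[x + y, z] = '[x, z] + '[y, z].
Proof. exact: (linearDl (@inner R H)). Qed.

Lemma innerDr x y z : '[z, x + y] = '[z, x] + '[z, y].
Proof. exact: (linearDr (@inner R H)). Qed.

Lemma innerNl x y : '[- x, y] = - '[x, y].
Proof. exact: (linearNl (@inner R H)). Qed.

Lemma innerNr x y : '[x, - y] = - '[x, y].
Proof. exact: (linearNr (@inner R H)). Qed.

Lemma inner_ge0 x : 0 <= '[x, x].
Proof. by rewrite inner_normE exprn_ge0. Qed.

Lemma inner_eq0 x : '[x, x] = 0 -> x = 0.
Proof. by rewrite inner_normE => /eqP; rewrite sqrf_eq0 normr_eq0 => /eqP. Qed.

Lemma inner_CauchySchwarz x y : `|'[x, y]| <= `|x| * `|y|.
Proof.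
have [->|y0] := eqVneq y 0.
  by rewrite linear0r !normr0 mulr0.
have yy0 : 0 < '[y, y] by rewrite inner_normE exprn_gt0// normr_gt0.
rewrite -ler_sqr ?nnegrE ?mulr_ge0// exprMn -!inner_normE.
rewrite -subr_ge0 -(pmulr_rge0 _ yy0).
have -> : '[y, y] * ('[x, x] * '[y, y] - `|'[x, y]| ^+ 2) =
    '['[y, y] *: x - '[x, y] *: y, '[y, y] *: x - '[x, y] *: y].
  rewrite linearBl !linearBr/= !innerZl !innerZr normCK (inner_conj y x).
  by rewrite (conj_Creal (gtr0_real yy0)); ring.
exact: inner_ge0.
Qed.

Lemma inner_ext x y : (forall z, '[x, z] = '[y, z]) -> x = y.
Proof.
move=> xy; apply/eqP; rewrite -subr_eq0; apply/eqP/inner_eq0.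
by rewrite linearBl/= xy subrr.
Qed.

(** Replacing [y] by ['i *: y] recovers the sesquilinear term from its
    symmetrization. *)
Lemma offdiag_eq0 (B : bop H H) x y :
  '[B x, y] + '[B y, x] = 0 -> '[B x, 'i *: y] + '[B ('i *: y), x] = 0 ->
  '[B x, y] = 0.
Proof.
rewrite (_ : B ('i *: y) = 'i *: B y); last by rewrite linearZ.
rewrite innerZl innerZr conjCi => /eqP; rewrite addrC addr_eq0 => /eqP ->.
rewrite mulrN mulNr -opprD => /eqP; rewrite oppr_eq0 -mulrDr mulf_eq0.
by rewrite (negbTE (neq0Ci _))/= -mulr2n mulrn_eq0/= => /eqP.
Qed.

Lemma inner_real_sym x y : '[x, y] \is Num.real -> '[y, x] = '[x, y].
Proof. by move=> r; rewrite inner_conj conj_Creal. Qed.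

Lemma form_real (T : bop H H) : selfadjoint T -> forall x, '[T x, x] \is Num.real.
Proof. by move=> sT x; rewrite CrealE -inner_conj sT. Qed.

Lemma selfadjoint_shift (T : bop H H) a : a \is Num.real ->
  selfadjoint T -> selfadjoint (T - a *: bop_id H).
Proof.
move=> ra sT x y.
rewrite (_ : (T - _) x = T x - a *: x)// (_ : (T - _) y = T y - a *: y)//.
by rewrite linearBl linearBr/= sT innerZl innerZr conj_Creal.
Qed.

Lemma form_affine (T : bop H H) a x : selfadjoint T -> a \is Num.real ->
  '[T (x + a *: T x), x + a *: T x] =
  '[T x, x] + a *+ 2 * '[T x, T x] + a ^+ 2 * '[T (T x), T x].
Proof.
move=> sT ra; rewrite !(linearD, linearZ)/= !linearDl !linearDr/=.
rewrite ?innerZl ?innerZr !conj_Creal// (sT (T x) x).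
by rewrite ?mulr2n; ring.
Qed.

Lemma sqr_affine (T : bop H H) a x : selfadjoint T -> a \is Num.real ->
  '[x + a *: T x, x + a *: T x] =
  '[x, x] + a *+ 2 * '[T x, x] + a ^+ 2 * '[T x, T x].
Proof.
move=> sT ra; rewrite !linearDl !linearDr/=.
rewrite ?innerZl ?innerZr !conj_Creal// -(sT x x).
by rewrite ?mulr2n; ring.
Qed.

Lemma sqr_bop_le (T : bop H H) e x : 0 <= e -> e * `|T| <= 1 ->
  e ^+ 2 * '[T x, T x] <= '[x, x].
Proof.
move=> e0 eT; rewrite !inner_normE -exprMn ler_sqr ?nnegrE ?mulr_ge0//.
rewrite (le_trans (ler_wpM2l e0 (ler_bop_norm T x)))//.
by rewrite mulrA ler_piMl.
Qed.

Lemma form_le (T : bop H H) e x : selfadjoint T -> 0 <= e -> e * `|T| <= 1 ->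
  e * '[T x, x] <= '[x, x].
Proof.
move=> sT e0 eT; rewrite -subr_ge0.
have := inner_ge0 (x + (- e) *: T x).
rewrite sqr_affine ?rpredN ?ger0_real// => h.
have -> : '[x, x] - e * '[T x, x] = 2^-1 *
  (('[x, x] + (- e) *+ 2 * '[T x, x] + (- e) ^+ 2 * '[T x, T x]) +
   ('[x, x] - e ^+ 2 * '[T x, T x])) by field.
by rewrite mulr_ge0// addr_ge0// subr_ge0 sqr_bop_le.
Qed.

(** The Cauchy-Schwarz bound [|T x|^2 <= |T| '[T x, x]] of a nonnegative form,
    with positivity asked at a single vector: the form at [x - e *: T x] is
    quadratic in [e].  Asking it at one vector lets the bound be used on a
    [T]-invariant subspace. *)
Lemma sqr_le_form (T : bop H H) e x : selfadjoint T -> 0 <= e -> e * `|T| <= 1 ->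
  0 <= '[T (x - e *: T x), x - e *: T x] -> e * '[T x, T x] <= '[T x, x].
Proof.
move=> sT e0 eT; rewrite -scaleNr form_affine ?rpredN ?ger0_real// => h.
rewrite -subr_ge0.
have -> : '[T x, x] - e * '[T x, T x] =
  ('[T x, x] + (- e) *+ 2 * '[T x, T x] + (- e) ^+ 2 * '[T (T x), T x]) +
   e * ('[T x, T x] - e * '[T (T x), T x]) by ring.
by rewrite addr_ge0// mulr_ge0// subr_ge0 form_le.
Qed.

(** A step small enough for [T] to be a contraction once scaled; the [+ 1]
    covers [T = 0]. *)
Definition step_size (T : bop H H) : R[i] := (`|T| + 1)^-1.

Lemma step_size_gt0 T : 0 < step_size T.
Proof. by rewrite invr_gt0 ltr_wpDl. Qed.

Lemma step_size_le T : step_size T * `|T| <= 1.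
Proof. by rewrite mulrC ler_pdivrMr ?ltr_wpDl// mul1r lerDl. Qed.

Lemma ker_of_form_eq0 (T : bop H H) x : selfadjoint T ->
  (forall y, 0 <= '[T y, y]) -> '[T x, x] = 0 -> T x = 0.
Proof.
move=> sT T0 Tx; have s0 := step_size_gt0 T.
have := sqr_le_form (x := x) sT (ltW s0) (step_size_le T) (T0 _).
rewrite Tx pmulr_rle0// => le0; apply: inner_eq0.
by apply: le_anti; rewrite le0 inner_ge0.
Qed.

End inner_product.

Section rank_one.
Context {R : realType} {H0 H1 : hilbertType R}.

Lemma rank_one_bop (x0 : H0) (y0 : H1) :
  exists T : bop H0 H1, forall x, T x = '[x, x0] *: y0.
Proof.
pose f x := '[x, x0] *: y0.
have lf : linear f.
  by move=> a x x'; rewrite /f innerDl innerZl scalerDl scalerA.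
pose g : {linear H0 -> H1} := HB.pack f (GRing.isLinear.Build _ _ _ _ f lf).
have cf : continuous f.
  apply: (@bounded_linear_continuous _ _ _ g); apply/linear_boundedP.
  exists (`|x0| * `|y0|); split; first by rewrite ger0_real// mulr_ge0.
  move=> r /ltW Mr x; rewrite /g /= /f normrZ.
  apply: le_trans (ler_wpM2r (normr_ge0 _) (inner_CauchySchwarz _ _)) _.
  by rewrite -mulrA mulrC ler_wpM2r.
have fP : f \in @is_bop _ H0 H1 by rewrite inE.
by exists (Bop f fP).
Qed.

End rank_one.

(** * Iterating 1 + eT *)

Section power_iteration.
Context {R : realType} {H : hilbertType R} (T : bop H H) (e : R[i]).
Hypotheses (T_sa : selfadjoint T) (e_gt0 : 0 < e).
Implicit Types x y : H.

Let e_ge0 : 0 <= e. Proof. exact: ltW. Qed.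
Let e_real : e \is Num.real. Proof. exact: ger0_real. Qed.

Definition euler_step x := x + e *: T x.
Local Notation S := euler_step.

Let S_sym x y : '[S x, y] = '[x, S y].
Proof.
by rewrite linearDl linearDr/= innerZl innerZr conj_Creal// T_sa.
Qed.

Let iterS_sym n x y : '[iter n S x, y] = '[x, iter n S y].
Proof. by elim: n x y => // n IH x y; rewrite iterS S_sym IH -iterSr. Qed.

Let iterS_inner x i j :
  '[iter i S x, iter j S x] = '[iter (i + j) S x, x].
Proof. by rewrite -iterS_sym -iterD addnC. Qed.

Let T_iterS n x : T (iter n S x) = iter n S (T x).
Proof. by elim: n => // n IH; rewrite !iterS -IH /S linearD linearZ. Qed.

(** The form ['[T x, x]] does not decrease along the iteration, so each step
    adds at least [2 e '[T x, x]] to the squared norm. *)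
Lemma euler_growth x : (forall n, 0 <= '[T (iter n S x), iter n S x]) ->
  (forall n, 0 <= '[T (iter n S (T x)), iter n S (T x)]) ->
  forall n, '[x, x] + e *+ 2 * '[T x, x] *+ n <= '[iter n S x, iter n S x].
Proof.
move=> T0 TT0.
have Tle n : '[T x, x] <= '[T (iter n S x), iter n S x].
  elim: n => // n /le_trans; apply; rewrite iterS form_affine// -addrA lerDl.
  rewrite addr_ge0 ?mulr_ge0 ?mulrn_wge0 ?inner_ge0 ?exprn_ge0//.
  by rewrite T_iterS.
elim=> [|n IH]; first by rewrite mulr0n addr0.
rewrite iterS sqr_affine// mulrSr addrA -(addrA '[iter n euler_step x, _]) lerD//.
rewrite -[leLHS]addr0 lerD//; last by rewrite mulr_ge0 ?exprn_ge0 ?inner_ge0.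
by rewrite ler_wpM2l// mulrn_wge0.
Qed.

Lemma euler_decay_step x :
  '[T x, x] <= 0 -> e * '[T x, T x] <= - '[T x, x] ->
  '[S x, x] <= '[x, x] /\ '[S x, S x] <= '[S x, x].
Proof.
move=> T0 TT; rewrite sqr_affine// linearDl/= innerZl; split.
  by rewrite gerDl mulr_ge0_le0.
rewrite -subr_ge0.
have -> : '[x, x] + e * '[T x, x] -
  ('[x, x] + e *+ 2 * '[T x, x] + e ^+ 2 * '[T x, T x]) =
  e * (- '[T x, x] - e * '[T x, T x]) by ring.
by rewrite mulr_ge0// subr_ge0.
Qed.

Section decay.
Variable x : H.
Hypothesis T_le0 : forall n, '[T (iter n S x), iter n S x] <= 0.
Hypothesis T_small : forall n,
  e * '[T (iter n S x), T (iter n S x)] <= - '[T (iter n S x), iter n S x].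

(** The moments ['[S ^ k x, x]] decrease with [k] since [0 <= S <= 1] along
    the orbit of [x]; even and odd [k] use the two halves of
    [euler_decay_step]. *)
Lemma euler_moments_le n k :
  '[iter (n + k) S x, iter (n + k) S x] <= '[iter n S x, iter (n + k) S x].
Proof.
pose s k := '[iter k S x, x].
have sE i j : '[iter i S x, iter j S x] = s (i + j)%N by exact: iterS_inner.
have s_dec j : s j.+1 <= s j.
  rewrite -(odd_double_half j) -addnn; case: (odd j) => /=.
    have -> : (1 + (j./2 + j./2)).+1 = (j./2.+1 + j./2.+1)%N.
      by rewrite addSn addnS.
    rewrite (_ : 1 + _ = j./2.+1 + j./2)%N// -!sE !iterS.
    by have [_] := euler_decay_step (T_le0 j./2) (T_small j./2).
  rewrite add0n -addSn -!sE iterS.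
  by have [+ _] := euler_decay_step (T_le0 j./2) (T_small j./2).
rewrite !sE -addnA addnCA; move: (n + (n + k))%N => m.
by elim: k => // k IH; rewrite addSn (le_trans (s_dec _)).
Qed.

Lemma euler_cauchy n k :
  '[iter n S x - iter (n + k) S x, iter n S x - iter (n + k) S x] <=
  '[iter n S x, iter n S x] - '[iter (n + k) S x, iter (n + k) S x].
Proof.
rewrite linearBl/= !linearBr/=.
set a := '[iter n S x, _]; set b := '[_, iter (n + k) S x].
have cb : '[iter (n + k) S x, iter n S x] = b.
  by rewrite /b !iterS_inner addnC.
rewrite cb; set c := '[_, iter (n + k) S x].
have h : c <= b by exact: euler_moments_le.
rewrite -subr_ge0.
have -> : a - c - (a - b - (b - c)) = (b - c) *+ 2 by ring.
by rewrite mulrn_wge0// subr_ge0.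
Qed.

Lemma euler_decay_le n : '[iter n S x, iter n S x] <= '[x, x].
Proof.
elim: n => // n /(le_trans _); apply; rewrite iterS.
have [h1 h2] := euler_decay_step (T_le0 n) (T_small n).
exact: le_trans h2 h1.
Qed.

Let sqr_norm n := complex.Re '[iter n S x, iter n S x].

Let sqr_normE n : '[iter n S x, iter n S x] = (sqr_norm n)%:C.
Proof. by rewrite RRe_real// ger0_real// inner_ge0. Qed.

Let sqr_norm_dec : nonincreasing_seq sqr_norm.
Proof.
apply/nonincreasing_seqP => n; rewrite -lecR -!sqr_normE iterS.
have [h1 h2] := euler_decay_step (T_le0 n) (T_small n).
exact: le_trans h2 h1.
Qed.

Let sqr_norm_cvg : cvgn sqr_norm.
Proof.
apply: nonincreasing_is_cvgn sqr_norm_dec _.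
by exists 0 => _ [n _ <-]; rewrite -lecR -sqr_normE inner_ge0.
Qed.

(** Decreasing squared norms make the orbit Cauchy, by [euler_cauchy]; its
    limit is fixed by [S], hence killed by [T].  This is the mean ergodic
    theorem for the contraction [S]. *)
Lemma euler_cvg : exists2 y, (fun n => iter n S x) @ \oo --> y & T y = 0.
Proof.
pose u n := iter n S x.
have /cvg_ex[y uy] : cvg (u @ \oo).
  apply: cauchy_cvg; apply/cauchy_ballP => d d0.
  pose r := complex.Re d.
  have dE : d = r%:C by rewrite RRe_real// gtr0_real.
  have r0 : 0 < r by rewrite -ltcR -dE.
  have [N _ Nr] : \forall n \near \oo, sqr_norm n < limn sqr_norm + r ^+ 2.
    apply: (cvgr_lt _ sqr_norm_cvg).
    by rewrite ltrDl exprn_gt0.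
  exists (u @` [set n | (N <= n)%N], u @` [set n | (N <= n)%N]) => /=.
    by split; exists N => // n /= Nn; exists n.
  have close n k : (N <= n)%N -> `|u n - u (n + k)%N| < d.
    move=> Nn; rewrite -ltr_sqr ?nnegrE ?(ltW d0)// -inner_normE.
    apply: le_lt_trans (euler_cauchy n k) _.
    rewrite !sqr_normE dE -rmorphB -rmorphXn ltcR ltrBlDl.
    apply: lt_le_trans (Nr n Nn) _; rewrite lerD2r.
    exact: nonincreasing_cvgn_ge sqr_norm_dec sqr_norm_cvg _.
  move=> [_ _] [[n /= Nn <-] [m /= Nm <-]]; rewrite -ball_normE /ball_/=.
  have [nm|/ltnW mn] := leqP n m; first by rewrite -(subnKC nm) close.
  by rewrite -(subnKC mn) distrC close.
exists y => //.
have uy1 : (fun n => u n.+1) @ \oo --> y.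
  by rewrite (_ : (fun n => u n.+1) = (fun n => u (n + 1)%N)) ?cvg_shiftn//;
    apply/funext => n; rewrite addn1.
have uTy : (fun n => u n.+1) @ \oo --> y + e *: T y.
  rewrite (_ : (fun n => u n.+1) = (fun n => u n + e *: T (u n)))//.
  apply: cvgD => //; apply: cvgZr.
  exact: continuous_cvg _ (bop_continuous (x:=y)) uy.
have : y + e *: T y = y by apply: cvg_unique uTy uy1.
move/eqP; rewrite -[in eqbRHS](addr0 y) (inj_eq (addrI y)) scaler_eq0.
by rewrite gt_eqF//= => /eqP.
Qed.

End decay.

End power_iteration.

(** * Invariant sets close to the nonpositive part *)

Lemma archi_eq0 (R : realType) (c M : R[i]) :
  0 <= c -> (forall n, c *+ n <= M) -> c = 0.
Proof.
move=> c0 cM; apply: contrapT => /eqP cn0.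
have M0 : 0 <= M by have := cM 0%N; rewrite mulr0n.
pose r := complex.Re c; pose m := complex.Re M.
have cE : c = r%:C by rewrite RRe_real// ger0_real.
have ME : M = m%:C by rewrite RRe_real// ger0_real.
have r0 : 0 < r by rewrite -ltcR -cE lt_neqAle eq_sym cn0.
have m0 : 0 <= m by rewrite -lecR -ME.
have := cM (Num.bound (m / r)).
rewrite cE ME -rmorphMn lecR leNgt => /negP; apply.
by rewrite -mulr_natl -ltr_pdivrMr// archi_boundP// divr_ge0// ltW.
Qed.

(** Here [P] splits the space into a part where [T] is nonnegative and a part
    where it is nonpositive, and [L] is a [T]-invariant set, such as the graph
    of another solution, that stays close to the nonpositive part. *)
Section splitting.
Context {R : realType} {H : hilbertType R} (T P : bop H H) (L : set H).
Hypothesis T_sa : selfadjoint T.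
Hypothesis P_idem : forall u, P (P u) = P u.
Hypothesis P_comm : forall u, P (T u) = T (P u).
Hypothesis P_ge0 : forall u, 0 <= '[T (P u), P u].
Hypothesis P_le0 : forall u, '[T (u - P u), u - P u] <= 0.
Hypothesis L_inv : forall u a, L u -> L (u + a *: T u).
Hypothesis L_close : forall u, L u -> `|P u| <= `|u - P u|.

Let e := step_size T.
Let e_gt0 : 0 < e. Proof. exact: step_size_gt0. Qed.
Let e_le : e * `|T| <= 1. Proof. exact: step_size_le. Qed.

Local Notation S := (euler_step T e).

Let P_iter n u : P (iter n S u) = iter n S (P u).
Proof.
elim: n => // n IH; rewrite !iterS -IH /euler_step.
by rewrite linearD linearZ/= P_comm.
Qed.

Let Q_iter n u : iter n S u - P (iter n S u) = iter n S (u - P u).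
Proof.
rewrite P_iter; elim: n => // n IH; rewrite !iterS -IH /euler_step.
by rewrite linearB/= scalerBr addrACA opprD.
Qed.

Let L_iter n u : L u -> L (iter n S u).
Proof. by move=> Lu; elim: n => // n IH; rewrite iterS; exact: L_inv. Qed.

Let Q_le0 u n : '[T (iter n S (u - P u)), iter n S (u - P u)] <= 0.
Proof. by rewrite -Q_iter P_le0. Qed.

Let Q_small u n : e * '[T (iter n S (u - P u)), T (iter n S (u - P u))] <=
  - '[T (iter n S (u - P u)), iter n S (u - P u)].
Proof.
set a := iter _ _ _.
have oppE x : (- T) x = - T x by [].
have -> : - '[T a, a] = '[(- T) a, a] by rewrite oppE linearNl.
have -> : '[T a, T a] = '[(- T) a, (- T) a].
  by rewrite oppE linearNl linearNr/= opprK.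
apply: sqr_le_form; rewrite ?normrN ?(ltW e_gt0)//.
  by move=> x y; rewrite !oppE linearNl linearNr/= T_sa.
rewrite !oppE scalerN opprK linearNl oppr_ge0.
exact: (Q_le0 u n.+1).
Qed.

Let PQ_sqr u n : L u -> '[iter n S (P u), iter n S (P u)] <=
  '[iter n S (u - P u), iter n S (u - P u)].
Proof.
move=> Lu; rewrite -P_iter -Q_iter !inner_normE ler_sqr ?nnegrE//.
exact: L_close (L_iter _ Lu).
Qed.

Lemma subset_of_pos_injective : (forall u, T (P u) = 0 -> P u = 0) ->
  forall u, L u -> P u = 0.
Proof.
move=> inj u Lu; apply: inj; apply: inner_eq0.
have grow := euler_growth T_sa e_gt0 (x := P u).
have c0 : e *+ 2 * '[T (P u), P u] = 0.
  apply: (@archi_eq0 _ _ '[u - P u, u - P u]) => [|n].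
    by rewrite mulr_ge0// mulrn_wge0// ltW.
  apply: le_trans _ (euler_decay_le T_sa e_gt0 (Q_le0 u) (Q_small u) n).
  apply: le_trans _ (PQ_sqr n Lu); apply: le_trans _ (grow _ _ n).
  - by rewrite lerDr inner_ge0.
  - by move=> k; rewrite -P_iter.
  - by move=> k; rewrite -P_comm -P_iter.
have {}c0 : '[T (P u), P u] = 0.
  by move/eqP: c0; rewrite mulf_eq0 mulrn_eq0/= gt_eqF//= => /eqP.
have := @sqr_le_form _ _ T e (P u) T_sa (ltW e_gt0) e_le.
rewrite c0 -P_comm -linearZ/= -linearB/= => /(_ (P_ge0 _)).
rewrite pmulr_rle0// => le0; apply/eqP.
by rewrite eq_le le0 inner_ge0.
Qed.

Lemma subset_of_neg_injective :
  (forall u, T (u - P u) = 0 -> u - P u = 0) ->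
  forall u, L u -> P u = 0.
Proof.
move=> inj u Lu.
have [y uy Ty0] := euler_cvg T_sa e_gt0 (Q_le0 u) (Q_small u).
have Py0 : P y = 0.
  have Pu0 : (fun n => P (iter n S (u - P u))) @ \oo --> (0 : H).
    rewrite (_ : (fun n => _) = (fun=> 0)); first exact: cvg_cst.
    by apply/funext => n; rewrite -Q_iter linearB/= P_idem subrr.
  apply: (cvg_unique _ _ Pu0) => //.
  exact: continuous_cvg _ (bop_continuous (x:=y)) uy.
have y0 : y = 0.
  have yE : y = y - P y by rewrite Py0 subr0.
  by rewrite yE; apply: inj; rewrite -yE.
have le n : `|P u| <= `|iter n S (u - P u)|.
  rewrite -ler_sqr ?nnegrE// -!inner_normE.
  apply: le_trans _ (PQ_sqr n Lu).
  have grow := euler_growth T_sa e_gt0 (x := P u).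
  apply: le_trans _ (grow _ _ n).
  - by rewrite lerDl mulrn_wge0// mulr_ge0// mulrn_wge0// ltW.
  - by move=> k; rewrite -P_iter.
  - by move=> k; rewrite -P_comm -P_iter.
apply/eqP; rewrite -normr_le0.
apply: contrapT => /negP; rewrite -real_ltNge ?normr_real// => Pu0.
move/cvgrPdist_lt : uy => /(_ _ Pu0)[N _ /(_ N (leqnn _))].
by rewrite y0 /= sub0r normrN => /(le_lt_trans (le N)); rewrite ltxx.
Qed.

End splitting.

(** * Spectral measures *)

Import HBNNSimple.

(** A spectral distribution is a set function with unspecified values on
    nonmeasurable sets, hence not an instance of a measure; this lemma
    transfers its integrals to those of a genuine measure. *)
Lemma eq_integral_of_measurable d (T : measurableType d) (R : realType)
    (m1 m2 : set T -> \bar R) (D : set T) (f : T -> \bar R) :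
  (forall A, measurable A -> m1 A = m2 A) ->
  (\int[m1]_(x in D) f x = \int[m2]_(x in D) f x)%E.
Proof.
move=> m12; rewrite /integral; congr (ereal_sup _ - ereal_sup _)%E;
  apply: eq_imagel => h _; apply: eq_fsbigr => r _; rewrite m12//;
  by rewrite -[X in measurable X]setTI; exact: measurable_funP1.
Qed.

Section pvm.
Context {R : realType} {H : hilbertType R} (E : set R -> bop H H).
Hypothesis E_pvm : projection_valued_measure E.
Implicit Types (x y : H) (D A : set R).

Lemma pvm_sym D x y : measurable D -> '[E D x, y] = '[x, E D y].
Proof. by move=> /(pvm_proj E_pvm)[+ _]; exact. Qed.

Lemma pvm_comp D A x : measurable D -> measurable A ->
  E D (E A x) = E (D `&` A) x.
Proof. by move=> mD mA; rewrite (pvm_setI E_pvm). Qed.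

Lemma pvm_set0E x : E set0 x = 0.
Proof. by rewrite (pvm_set0 E_pvm). Qed.

Lemma pvm_form D x : measurable D -> '[E D x, x] = '[E D x, E D x].
Proof. by move=> mD; rewrite -pvm_sym// pvm_comp// setIid. Qed.

Lemma pvm_disjoint D A x : measurable D -> measurable A -> D `&` A = set0 ->
  E D (E A x) = 0.
Proof. by move=> mD mA DA; rewrite pvm_comp// DA pvm_set0E. Qed.

Lemma pvm_setU D A x : measurable D -> measurable A -> D `&` A = set0 ->
  E (D `|` A) x = E D x + E A x.
Proof.
move=> mD mA DA0.
have mF n : measurable (bigcup2 D A n) by case: n => [|[|n]] /=.
have tF : trivIset setT (bigcup2 D A).
  by rewrite -trivIset_bigcup2.
have := @pvm_sigma_additive _ _ _ E_pvm _ mF tF x; rewrite bigcup2E.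
move=> h; apply: (cvg_unique _ h) => //.
apply: cvg_near_cst; exists 2%N => // -[|[|n]]// _.
rewrite !big_ord_recl big1//= ?addr0// => i _.
exact: pvm_set0E.
Qed.

Lemma pvm_setC D x : measurable D -> x = E D x + E (~` D) x.
Proof.
move=> mD; rewrite -pvm_setU ?setICr//; last exact: measurableC.
by rewrite setUv (pvm_setT E_pvm).
Qed.

Lemma spectral_distribution_measure x :
  exists mu : {measure set R -> \bar R},
    forall D, measurable D -> mu D = spectral_distribution E x D.
Proof.
(* A measure has to be nonnegative on nonmeasurable sets as well. *)
pose mu D := if `[< measurable D >] then spectral_distribution E x D else 0%E.
have muE D : measurable D -> mu D = spectral_distribution E x D.
  by move=> mD; rewrite /mu asboolT.
have mu0 : mu set0 = 0%E.
  by rewrite muE// /spectral_distribution pvm_set0E linear0l.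
have mu_ge0 D : (0%:E <= mu D)%E.
  rewrite /mu; case: asboolP => // mD.
  rewrite lee_fin pvm_form// -lecR RRe_real ?inner_ge0//.
  by rewrite ger0_real// inner_ge0.
have mu_add : semi_sigma_additive (mu : set R -> \bar R).
  move=> F mF tF mU; rewrite muE//.
  have reE n : (\sum_(0 <= i < n) mu (F i))%E =
      (complex.Re '[\sum_(k < n) E (F k) x, x])%:E.
    rewrite linear_sumlz raddf_sum/= big_mkord -sumEFin.
    by apply: eq_bigr => i _; exact: muE (mF i).
  rewrite (eq_cvg _ _ reE).
  apply/fine_cvgP; split; first exact: nearW.
  rewrite /comp/=; apply/cvgrPdist_le => d d0.
  have := @pvm_sigma_additive _ _ _ E_pvm _ mF tF x.
  have nx : 0 < `|x| + 1 by rewrite ltr_wpDl.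
  have d1 : 0 < d%:C / (`|x| + 1) by rewrite divr_gt0// ltcR.
  move=> /cvgrPdist_le/(_ _ d1); apply: filterS => n hn.
  rewrite -raddfB/= -linearBl -lecR.
  apply: le_trans (normc_ge_Re _) _; apply: le_trans (inner_CauchySchwarz _ _) _.
  apply: le_trans (ler_wpM2r _ hn) _ => //.
  by rewrite mulrAC ler_pdivrMr// ler_wpM2l ?lecR ?(ltW d0)// lerDl.
pose m : {measure set R -> \bar R} :=
  HB.pack mu (isMeasure.Build _ _ _ mu mu0 mu_ge0 mu_add).
by exists m.
Qed.
End pvm.

Section spectral_measure.
Context {R : realType} {H : hilbertType R} (B : bop H H) (E : set R -> bop H H).
Hypothesis BE : is_spectral_measure B E.
Implicit Types (x y p q : H) (D A : set R).

Let E_pvm : projection_valued_measure E := proj1 BE.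

Lemma spectral_formE (mu : set R -> \bar R) x :
  (forall D, measurable D -> mu D = spectral_distribution E x D) ->
  mu.-integrable [set: R] EFin /\
  '[B x, x] = (fine (\int[mu]_t t%:E)%E)%:C.
Proof.
move=> muE; have [int ->] := BE.2 x; split; last first.
  by congr (_ %:C); congr fine; apply: eq_integral_of_measurable => D /muE.
move/integrableP : int => [mf intf]; apply/integrableP; split => //.
by rewrite (eq_integral_of_measurable _ _ muE).
Qed.

Lemma spectral_distributionD D A x : measurable D -> measurable A ->
  spectral_distribution E x A = (spectral_distribution E (E D x) A +
     spectral_distribution E (E (~` D) x) A)%E.
Proof.
move=> mD mA; have mC := measurableC mD.
have sd D' : measurable D' -> '[E A (E D' x), E D' x] = '[E (A `&` D') x, x].
  move=> mD'; have mAD := measurableI _ _ mA mD'.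
  rewrite -(pvm_sym E_pvm)// (pvm_comp E_pvm x)// (pvm_comp E_pvm x)//.
  by rewrite setIC -setIA setIid.
rewrite -EFinD -raddfD/= !sd// -linearDl/= -(pvm_setU E_pvm) ?setIUr.
- by rewrite -setIUr setUv setIT.
- exact: measurableI.
- exact: measurableI.
- by rewrite setIACA setICr setI0.
Qed.

(** The distribution of [x] is the sum of those of its components along [D]
    and its complement, and the integral is additive in the measure. *)
Lemma spectral_form_split D x : measurable D ->
  '[B x, x] = '[B (E D x), E D x] + '[B (E (~` D) x), E (~` D) x].
Proof.
move=> mD.
have [m1 m1E] := spectral_distribution_measure E_pvm (E D x).
have [m2 m2E] := spectral_distribution_measure E_pvm (E (~` D) x).
have [i1 ->] := spectral_formE m1E.
have [i2 ->] := spectral_formE m2E.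
have [|_ ->] := @spectral_formE (measure_add m1 m2) x.
  by move=> A mA; rewrite measure_addE m1E// m2E// -spectral_distributionD.
by rewrite integral_measure_add// fineD ?integrable_fin_num// rmorphD.
Qed.

(** The cross terms that [spectral_form_split] forbids, polarized. *)
Lemma spectral_offdiag D p q : measurable D -> '[B (E D p), E (~` D) q] = 0.
Proof.
move=> mD; have mC := measurableC mD.
have offdiag q' : '[B (E D p), E (~` D) q'] + '[B (E (~` D) q'), E D p] = 0.
  have := spectral_form_split (E D p + E (~` D) q') mD.
  have -> : E D (E D p + E (~` D) q') = E D p.
    by rewrite linearD/= pvm_comp// setIid pvm_disjoint ?setICr// addr0.
  have -> : E (~` D) (E D p + E (~` D) q') = E (~` D) q'.
    rewrite linearD/= pvm_comp// setICl (pvm_comp E_pvm)// setIid.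
    by rewrite pvm_set0E// add0r.
  rewrite (linearD B)/= innerDl !innerDr => /eqP.
  rewrite -subr_eq0 => /eqP h; rewrite -[RHS]h; ring.
apply: offdiag_eq0 => //.
by have := offdiag ('i *: q); rewrite linearZ.
Qed.

Lemma spectral_comm D x : measurable D -> B (E D x) = E D (B x).
Proof.
move=> mD; have mC := measurableC mD; apply: inner_ext => z.
rewrite (pvm_sym E_pvm)// {1}(pvm_setC E_pvm z mD) innerDr spectral_offdiag// addr0.
rewrite [in RHS](pvm_setC E_pvm x mD) (linearD B)/= innerDl.
have := spectral_offdiag x z mC; rewrite setCK => ->.
by rewrite addr0.
Qed.

End spectral_measure.

Section spectral_sign.
Context {R : realType} {H : hilbertType R} (B : bop H H) (E : set R -> bop H H).
Hypothesis BE : is_spectral_measure B E.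

Let E_pvm : projection_valued_measure E := proj1 BE.

Section on_range.
Variables (D : set R) (mD : measurable D) (p : H) (Ep : E D p = p) (l s : R).

(** The distribution of a vector in the range of [E D] is carried by [D].
    The sign [s] is there to treat spectra below and above [l] at once. *)
Let spectral_shift_form : exists2 m : {measure set R -> \bar R},
  (m D = (complex.Re '[p, p])%:E /\
   m.-integrable D (fun t => (s * (t - l))%:E)) &
  s%:C * ('[B p, p] - l%:C * '[p, p]) =
    (fine (\int[m]_(t in D) (s * (t - l))%:E)%E)%:C.
Proof.
have [m mE] := spectral_distribution_measure E_pvm p.
have [it Bp] := spectral_formE BE mE.
have mC := measurableC mD.
have mDE : m D = (complex.Re '[p, p])%:E.
  by rewrite mE// /spectral_distribution Ep.
have mC0 : m (~` D) = 0%E.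
  rewrite mE// /spectral_distribution -Ep (pvm_disjoint E_pvm)// ?setICl//.
  by rewrite linear0l.
have mTE : m setT = (complex.Re '[p, p])%:E.
  by rewrite mE// /spectral_distribution (pvm_setT E_pvm).
have il : m.-integrable [set: R] (fun=> l%:E).
  apply/integrableP; split; first exact: measurable_cst.
  by rewrite (integral_cst m measurableT) mTE -EFinM ltry.
have itl : m.-integrable [set: R] (fun t => (t - l)%:E).
  by rewrite (_ : (fun t => _) = (EFin \- cst l%:E)%E)//; exact: integrableB.
have itlD : m.-integrable D (fun t => (t - l)%:E).
  exact: integrableS itl.
exists m; first split => //.
  rewrite (_ : (fun t => _) = (fun t => s%:E * (t - l)%:E)%E)//.
  exact: integrableZl.
have -> : '[B p, p] - l%:C * '[p, p] =
    (fine (\int[m]_(t in D) (t - l)%:E)%E)%:C.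
  have -> : (\int[m]_(t in D) (t - l)%:E = \int[m]_t (t - l)%:E)%E.
    by rewrite [RHS](negligible_integral mC)// setTD setCK.
  rewrite (_ : (fun t => (t - l)%:E) = (EFin \- cst l%:E)%E)//.
  rewrite integralB// fineB ?integrable_fin_num// rmorphB/= -Bp.
  rewrite (integral_cst m measurableT) mTE -EFinM/= rmorphM/= RRe_real//.
  by rewrite ger0_real// inner_ge0.
rewrite -rmorphM; congr (_%:C).
rewrite (_ : (fun t => (s * _)%:E) = (fun t => s%:E * (t - l)%:E)%E)//.
by rewrite integralZl// fineM// integrable_fin_num.
Qed.

Lemma spectral_sign_ge0 : (forall t, D t -> 0 <= s * (t - l)) ->
  0 <= s%:C * ('[B p, p] - l%:C * '[p, p]).
Proof.
move=> s0; have [m _ ->] := spectral_shift_form.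
by rewrite lecR fine_ge0// integral_ge0// => t /s0; rewrite lee_fin.
Qed.

(** A positive function with zero integral forces the measure of [D], which is
    the squared norm of [p], to vanish. *)
Lemma spectral_sign_eq0 : (forall t, D t -> 0 < s * (t - l)) ->
  '[B p, p] - l%:C * '[p, p] = 0 -> p = 0.
Proof.
move=> s0; have [m [mDE ih] + p0] := spectral_shift_form.
rewrite p0 mulr0 => /esym h; apply: inner_eq0.
have {}h : (\int[m]_(t in D) `|(s * (t - l))%:E| = 0)%E.
  rewrite (eq_integral (fun t : R => (s * (t - l))%:E)); last first.
    by move=> t /set_mem /s0 /ltW; rewrite -lee_fin => /gee0_abs.
  rewrite -(fineK (integrable_fin_num mD ih)); congr (_%:E).
  by case: h.
move/(ae_eq_integral_abs m mD (measurable_int m ih)) : h => [N [mN N0 DN]].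
have : m D = 0%E.
  apply: subset_measure0 mD mN _ N0 => t Dt; apply: DN => /= /(_ Dt) [] /eqP.
  by rewrite gt_eqF// s0.
rewrite mDE => -[h]; rewrite -[LHS](RRe_real (ger0_real (inner_ge0 p))).
by rewrite h.
Qed.

End on_range.
End spectral_sign.

Section spectral_shift.
Context {R : realType} {H : hilbertType R} (B : bop H H) (E : set R -> bop H H).
Hypothesis BE : is_spectral_measure B E.
Variable l : R.
Implicit Types (u p : H) (D : set R).

Let E_pvm : projection_valued_measure E := proj1 BE.
Local Notation C := (B - l%:C *: bop_id H).

Let CE u : C u = B u - l%:C *: u. Proof. by []. Qed.

Let C_form p : '[C p, p] = '[B p, p] - l%:C * '[p, p].
Proof. by rewrite CE -scaleNr innerDl innerZl mulNr. Qed.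

Lemma spectral_shift_comm D u : measurable D -> C (E D u) = E D (C u).
Proof.
by move=> mD; rewrite !CE (spectral_comm BE)// (linearB (E D)) (linearZ_LR (E D)).
Qed.

Lemma form_below D u : measurable D -> (forall t, D t -> t <= l) ->
  '[C (E D u), E D u] <= 0.
Proof.
move=> mD Dl; have EE : E D (E D u) = E D u by rewrite (pvm_comp E_pvm)// setIid.
have := spectral_sign_ge0 BE mD EE (l := l) (s := -1).
rewrite C_form rmorphN1 mulN1r oppr_ge0; apply=> t /Dl tl.
by rewrite mulN1r oppr_ge0 subr_le0.
Qed.

Lemma form_above D u : measurable D -> (forall t, D t -> l <= t) ->
  0 <= '[C (E D u), E D u].
Proof.
move=> mD Dl; have EE : E D (E D u) = E D u by rewrite (pvm_comp E_pvm)// setIid.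
have := spectral_sign_ge0 BE mD EE (l := l) (s := 1).
by rewrite C_form rmorph1 mul1r; apply=> t /Dl tl; rewrite mul1r subr_ge0.
Qed.

Lemma ker_shift_away D u : measurable D ->
  (forall t, D t -> t < l) \/ (forall t, D t -> l < t) ->
  C (E D u) = 0 -> E D u = 0.
Proof.
move=> mD Dl Cu; have EE : E D (E D u) = E D u by rewrite (pvm_comp E_pvm)// setIid.
have := C_form (E D u); rewrite Cu linear0l => /esym.
case: Dl => Dl; [apply: (spectral_sign_eq0 (s := -1) BE mD EE)|
                 apply: (spectral_sign_eq0 (s := 1) BE mD EE)] => t /Dl tl.
  by rewrite mulN1r oppr_gt0 subr_lt0.
by rewrite mul1r subr_gt0.
Qed.

(** The form of [C] on the range of [E [set l]] is both nonnegative and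
    nonpositive; polarization turns this into an operator identity. *)
Lemma shift_set1_eq0 u : C (E [set l] u) = 0.
Proof.
have ml : measurable [set l] by exact: measurable_set1.
have form0 v : '[C (E [set l] v), E [set l] v] = 0.
  by apply: le_anti; rewrite form_below ?form_above// => t ->.
apply: inner_ext => z; rewrite linear0l.
have -> : '[C (E [set l] u), z] = '[C (E [set l] u), E [set l] z].
  rewrite -(pvm_sym E_pvm)// -spectral_shift_comm//.
  by rewrite (pvm_comp E_pvm)// setIid.
have offdiag v : '[C (E [set l] u), E [set l] v] +
    '[C (E [set l] v), E [set l] u] = 0.
  have := form0 (u + v).
  rewrite (linearD (E [set l])) (linearD C) innerDl !innerDr/=.
  by rewrite !form0 add0r addr0.
apply: offdiag_eq0 => //.
by have := offdiag ('i *: z); rewrite (linearZ_LR (E [set l])).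
Qed.

(** A kernel vector has no component in the ranges of [E] below or above [l],
    where the form of [C] is definite. *)
Lemma ker_shiftE u : C u = 0 -> E [set l] u = u.
Proof.
move=> Cu.
have ml : measurable [set l] by exact: measurable_set1.
have mlt : measurable [set t : R | t < l].
  by rewrite -set_itvNyo; exact: measurable_itv.
have mgt : measurable [set t : R | l < t].
  by rewrite -set_itvoy; exact: measurable_itv.
have E0 D : measurable D ->
    (forall t, D t -> t < l) \/ (forall t, D t -> l < t) -> E D u = 0.
  move=> mD Dl; apply: ker_shift_away Dl _ => //.
  by rewrite spectral_shift_comm// Cu linear0.
rewrite [RHS](pvm_setC E_pvm u ml).
have -> : ~` [set l] = [set t | t < l] `|` [set t | l < t].
  apply/seteqP; split => t /=; first by move/eqP; rewrite neq_lt => /orP.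
  by case=> h; apply/eqP; rewrite neq_lt h ?orbT.
rewrite (pvm_setU E_pvm)//.
  by rewrite (E0 _ mlt (or_introl _)) // (E0 _ mgt (or_intror _)) // !addr0.
by apply/seteqP; split => // t [/= h1 h2]; have := lt_trans h1 h2; rewrite ltxx.
Qed.
End spectral_shift.

(** * Quadratic forms and the spectrum *)

Section spectrum_form.
Context {R : realType} {H : hilbertType R}.
Implicit Type T : bop H H.

(** The supremum [m] of the Rayleigh quotients is in the spectrum: a bounded
    inverse of [m - T] would bound [|x|] by [|(m - T) x|], hence, by
    [sqr_le_form], ['[x, x]] by a multiple of ['[(m - T) x, x]], and keep the
    quotients away from [m]. *)
Lemma form_le_of_spectrum T (l : R) : selfadjoint T ->
  (forall r, l < r -> ~ spectrum T r%:C) ->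
  forall x, '[T x, x] <= l%:C * '[x, x].
Proof.
move=> sT hT.
pose A := [set r | exists2 x : H, x != 0 & '[T x, x] = r%:C * '[x, x]].
have gt0 x : x != 0 -> 0 < '[x, x].
  by move=> x0; rewrite inner_normE exprn_gt0// normr_gt0.
have ratio x : x != 0 -> exists2 r, A r & '[T x, x] = r%:C * '[x, x].
  move=> x0; pose r := complex.Re ('[T x, x] / '[x, x]).
  have rE : '[T x, x] = r%:C * '[x, x].
    rewrite RRe_real ?divfK ?gt_eqF ?gt0// rpredM ?form_real//.
    by rewrite rpredV ger0_real ?inner_ge0.
  by exists r => //; exists x.
have ubA : has_ubound A.
  exists (complex.Re (`|T| + 1)) => r [x x0 rE].
  rewrite -lecR RRe_real ?ger0_real ?addr_ge0//.
  have := form_le x sT (ltW (step_size_gt0 T)) (step_size_le T).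
  by rewrite rE mulrA ger_pMl ?gt0// mulrC ler_pdivrMr ?ltr_wpDl// mul1r.
move=> x0; apply: contrapT => /negP x0l.
have x0n0 : x0 != 0.
  by apply: contraNneq x0l => ->; rewrite (linear0 T) linear0l mulr0.
have [r0 Ar0 r0E] := ratio _ x0n0.
pose m := sup A.
have lm : l < m.
  apply: lt_le_trans (ub_le_sup ubA Ar0).
  move: x0l; rewrite r0E ler_pM2r ?gt0// lecR -ltNge.
  exact.
have [S [SK _]] : exists S : bop H H, S \ob (T - m%:C *: bop_id H) = bop_id H /\
    (T - m%:C *: bop_id H) \ob S = bop_id H.
  by apply: contrapT; exact: hT lm.
pose D : bop H H := m%:C *: bop_id H - T.
have DE x : D x = m%:C *: x - T x by [].
have D_form x r : '[T x, x] = r%:C * '[x, x] -> '[D x, x] = (m - r)%:C * '[x, x].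
  by move=> rE; rewrite DE innerDl innerNl innerZl rE rmorphB/=; ring.
have D_sa : selfadjoint D.
  move=> x y; rewrite !DE innerDl innerDr innerNl innerNr innerZl innerZr sT.
  by rewrite conj_Creal// complex_real.
have D_ge0 x : 0 <= '[D x, x].
  have [->|/ratio[r Ar /D_form ->]] := eqVneq x 0.
    by rewrite (linear0 D) linear0l.
  by rewrite mulr_ge0 ?inner_ge0// lecR subr_ge0 ub_le_sup.
pose f := step_size D; have f0 : 0 < f := step_size_gt0 D.
have fD : f * `|D| <= 1 := step_size_le D.
have SD x : '[x, x] <= `|S| ^+ 2 * '[D x, D x].
  have -> : '[x, x] = '[S (D x), S (D x)].
    have SDx : S (D x) = - x.
      rewrite DE -opprB (linearN S); congr (- _).
      exact: (congr1 (fun h : bop H H => h x) SK).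
    by rewrite SDx innerNl innerNr opprK.
  rewrite !inner_normE -exprMn ler_sqr ?nnegrE ?mulr_ge0//.
  exact: ler_bop_norm.
pose c : R[i] := f / (`|S| ^+ 2 + 1).
have S0 : 0 < `|S| ^+ 2 + 1 by rewrite ltr_wpDl ?exprn_ge0.
have c0 : 0 < c by rewrite divr_gt0.
have cD x : c * '[x, x] <= '[D x, x].
  rewrite mulrAC ler_pdivrMr//.
  apply: le_trans (ler_wpM2l (ltW f0) (SD x)) _.
  rewrite mulrCA [leRHS]mulrC.
  apply: ler_pM; rewrite ?exprn_ge0 ?mulr_ge0 ?inner_ge0 ?(ltW f0) ?lerDl//.
  by apply: sqr_le_form => //; exact: ltW.
have cE : c = (complex.Re c)%:C by rewrite RRe_real// gtr0_real.
have : m <= m - complex.Re c.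
  apply: ge_sup; first by exists r0.
  move=> r [x xn0 /D_form rE]; have := cD x.
  by rewrite rE ler_pM2r ?gt0// cE lecR lerBrDl lerBrDr.
by rewrite leNgt gtrBl -ltcR -cE c0.
Qed.
End spectrum_form.

Section spectrum_bounds.
Context {R : realType} {H : hilbertType R}.
Implicit Type T : bop H H.

Lemma spectrum_opp T z : spectrum (- T) z -> spectrum T (- z).
Proof.
move=> h [S [SK KS]]; apply: h; exists (- S).
have opp : - T - z *: bop_id H = - (T - - z *: bop_id H).
  by rewrite opprD scaleNr opprK.
rewrite opp; split; apply: bop_ext => x.
  change (- S (- (T - - z *: bop_id H) x) = x); rewrite (linearN S) opprK.
  exact: (congr1 (fun f : bop H H => f x) SK).
change (- (T - - z *: bop_id H) (- S x) = x).
rewrite (linearN (T - - z *: bop_id H)) opprK.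
exact: (congr1 (fun f : bop H H => f x) KS).
Qed.

Lemma form_le_sup T (l : R) : selfadjoint T ->
  (ereal_sup [set (complex.Re z)%:E | z in spectrum T] <= l%:E)%E ->
  forall x, '[T x, x] <= l%:C * '[x, x].
Proof.
move=> sT supT; apply: form_le_of_spectrum => // r lr Tr.
have : (r%:E <= l%:E)%E.
  by apply: le_trans supT; apply: ereal_sup_ubound; exists r%:C.
by rewrite lee_fin leNgt lr.
Qed.

Lemma inf_le_form T (l : R) : selfadjoint T ->
  (l%:E <= ereal_inf [set (complex.Re z)%:E | z in spectrum T])%E ->
  forall x, l%:C * '[x, x] <= '[T x, x].
Proof.
move=> sT infT x.
have oppE y : (- T) y = - T y by [].
rewrite -lerN2 -mulNr -innerNl -oppE -rmorphN.
apply: form_le_of_spectrum => [y z|r lr /spectrum_opp Tr].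
  by rewrite !oppE innerNl innerNr sT.
have : (l%:E <= (- r)%:E)%E.
  by apply: le_trans infT _; apply: ereal_inf_lbound; exists (- r%:C) => //=.
by rewrite lee_fin leNgt ltrNl lr.
Qed.

End spectrum_bounds.

(** * Block operators and the Riccati equation *)

Section block_operator.
Context {R : realType} (H0 H1 : hilbertType R) (A0 : bop H0 H0)
  (A1 : bop H1 H1) (V : bop H1 H0) (Vs : bop H0 H1).
Hypotheses (A0_sa : selfadjoint A0) (A1_sa : selfadjoint A1).
Hypothesis V_adj : is_adjoint V Vs.
Local Notation B := (block_op A0 A1 V Vs).
Implicit Types (u v : hsum H0 H1) (x : H0) (y : H1).

Lemma hsum_innerE u v : '[u, v] = '[u.1, v.1] + '[u.2, v.2].
Proof. by []. Qed.

Lemma Vs_adj x y : '[Vs x, y] = '[x, V y].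
Proof. by rewrite inner_conj -V_adj -inner_conj. Qed.

Lemma block_op_sa : selfadjoint B.
Proof.
move=> u v; rewrite !hsum_innerE /= !innerDl !innerDr A0_sa A1_sa V_adj Vs_adj.
by rewrite addrACA.
Qed.

Lemma riccatiP (Y : bop H0 H1) : riccati_solutions A0 A1 V Vs Y <->
  forall x, A1 (Y x) + Vs x = Y (A0 x + V (Y x)).
Proof.
split=> [h x|h].
  have h' : A1 (Y x) - Y (A0 x) - Y (V (Y x)) + Vs x = 0.
    exact: (congr1 (fun f : bop H0 H1 => f x) h).
  apply/eqP; rewrite (linearD Y) -subr_eq0 opprD addrA.
  by rewrite (addrAC (A1 _)) (addrAC (A1 _ - _)) h'.
apply: bop_ext => x; change (A1 (Y x) - Y (A0 x) - Y (V (Y x)) + Vs x = 0).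
by rewrite -(addrA (A1 _)) -opprD -linearD addrAC h subrr.
Qed.

Variable l : R.
Local Notation C := (B - l%:C *: bop_id (hsum H0 H1)).

Lemma block_shiftE u :
  C u = (A0 u.1 + V u.2 - l%:C *: u.1, Vs u.1 + A1 u.2 - l%:C *: u.2).
Proof. by []. Qed.

(** The Riccati equation says that the block operator maps [(x, Y x)] to a
    pair of the same form. *)
Lemma graph_block_inv (Y : bop H0 H1) u a : riccati_solutions A0 A1 V Vs Y ->
  graph Y u -> graph Y (u + a *: C u).
Proof.
move=> /riccatiP h [x _ <-].
exists (x + a *: (A0 x + V (Y x) - l%:C *: x)) => //.
rewrite block_shiftE/=.
rewrite (linearD Y) (linearZ_LR Y) (linearB Y) (linearZ_LR Y)/= -h.
by rewrite (addrC (A1 _)).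
Qed.

Hypothesis A0_le : forall x, '[A0 x, x] <= l%:C * '[x, x].
Hypothesis A1_ge : forall y, l%:C * '[y, y] <= '[A1 y, y].

Let K0 := ker (A0 - l%:C *: bop_id H0) `&` ker Vs.
Let K1 := ker (A1 - l%:C *: bop_id H1) `&` ker V.

(** With [D0 = l - A0] and [D1 = A1 - l], both nonnegative, [C (x, y) = 0] says
    [D0 x = V y] and [D1 y = - Vs x].  So ['[D0 x, x] = - '[D1 y, y]], and both
    forms vanish. *)
Lemma ker_block_shift u : C u = 0 <-> K0 u.1 /\ K1 u.2.
Proof.
rewrite /K0 /K1 /ker block_shiftE; case: u => x y /=; split; last first.
  move=> [[A0x Vsx] [A1y Vy]]; congr (_, _).
    by rewrite Vy addr0.
  by rewrite Vsx add0r.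
move=> [h1 h2].
have lr : l%:C \is Num.real by rewrite complex_real.
pose D0 := l%:C *: bop_id H0 - A0; pose D1 := A1 - l%:C *: bop_id H1.
have D0E z : D0 z = l%:C *: z - A0 z by [].
have D1E z : D1 z = A1 z - l%:C *: z by [].
have D0_sa : selfadjoint D0.
  move=> z z'; rewrite !D0E innerDl innerDr innerNl innerNr innerZl innerZr.
  by rewrite conj_Creal// A0_sa.
have D1_sa : selfadjoint D1 by exact: selfadjoint_shift.
have D0_ge0 z : 0 <= '[D0 z, z] by rewrite D0E innerDl innerNl innerZl subr_ge0.
have D1_ge0 z : 0 <= '[D1 z, z] by rewrite D1E innerDl innerNl innerZl subr_ge0.
have D0V : D0 x = V y by rewrite D0E -(subr0_eq h1) addrAC subrr add0r.
have D1V : D1 y = - Vs x.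
  by rewrite D1E -(subr0_eq h2) opprD addrCA subrr addr0.
have D01 : '[D0 x, x] = - '[D1 y, y].
  have r : '[V y, x] \is Num.real by rewrite -D0V form_real.
  by rewrite D1V innerNl opprK Vs_adj D0V (inner_real_sym r).
have D0x0 : '[D0 x, x] = 0.
  by apply: le_anti; rewrite D0_ge0 D01 oppr_le0 D1_ge0.
have D1y0 : '[D1 y, y] = 0.
  by apply/eqP; rewrite -oppr_eq0 -D01 D0x0.
have := ker_of_form_eq0 D0_sa D0_ge0 D0x0; rewrite D0V => Vy.
have := ker_of_form_eq0 D1_sa D1_ge0 D1y0; rewrite D1V => /eqP.
rewrite oppr_eq0 => /eqP Vsx.
split; split => //.
- by rewrite -h1 Vy addr0.
- by rewrite -h2 Vsx add0r.
Qed.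
End block_operator.

(** * Isolated solutions *)

Section isolation.
Context {R : realType} (H0 H1 : hilbertType R) (A0 : bop H0 H0)
  (A1 : bop H1 H1) (V : bop H1 H0) (Vs : bop H0 H1).
Hypotheses (A0_sa : selfadjoint A0) (A1_sa : selfadjoint A1).
Hypothesis V_adj : is_adjoint V Vs.
Variable l : R.
Local Notation H := (hsum H0 H1).
Local Notation B := (block_op A0 A1 V Vs).
Local Notation C := (B - l%:C *: bop_id H).
Local Notation K0 := (ker (A0 - l%:C *: bop_id H0) `&` ker Vs).
Local Notation K1 := (ker (A1 - l%:C *: bop_id H1) `&` ker V).

(** The quadratic terms of the equation drop because [V] kills the range of
    [T] and [T] kills the range of [V]; what remains, [A1 T = T A0], holds
    because [x0] and [y0] are eigenvectors for the same eigenvalue. *)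
Lemma riccati_perturbation (X T : bop H0 H1) x0 y0 a :
  riccati_solutions A0 A1 V Vs X -> K0 x0 -> K1 y0 ->
  (forall x, T x = '[x, x0] *: y0) ->
  riccati_solutions A0 A1 V Vs (X + a *: T).
Proof.
move=> /riccatiP Xsol [A0x0 Vsx0] [A1y0 Vy0] TE; apply/riccatiP => x.
have {}A0x0 : A0 x0 = l%:C *: x0 by exact: subr0_eq A0x0.
have {}A1y0 : A1 y0 = l%:C *: y0 by exact: subr0_eq A1y0.
have {}Vy0 : V y0 = 0 by [].
have {}Vsx0 : Vs x0 = 0 by [].
have VT z : V (T z) = 0 by rewrite TE bopZ Vy0 scaler0.
have TV z : T (V z) = 0 by rewrite TE V_adj Vsx0 linear0r scale0r.
have AT z : A1 (T z) = T (A0 z).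
  rewrite !TE bopZ A1y0 A0_sa A0x0 innerZr conj_Creal ?complex_real//.
  by rewrite scalerA mulrC.
have YE z : (X + a *: T) z = X z + a *: T z by [].
rewrite !YE (bopD A1) (bopD V) (bopZ A1) (bopZ V) VT scaler0 addr0.
by rewrite addrAC Xsol AT (bopD T) TV addr0.
Qed.

Lemma isolated_ker_trivial (X : bop H0 H1) :
  isolated (riccati_solutions A0 A1 V Vs) X -> K0 = [set 0] \/ K1 = [set 0].
Proof.
move=> [/set_mem Xsol [U UX UXE]]; apply: contrapT => /not_orP[K0n K1n].
have nontrivial (W : hilbertType R) (K : set W) :
    K 0 -> K <> [set 0] -> exists2 x, K x & x != 0.
  move=> K00 Kn; apply: contrapT => h; apply: Kn; apply/seteqP.
  split=> [x Kx|_ ->//].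
  by apply/eqP; apply: contrapT => /negP xn0; apply: h; exists x.
have [x0 K0x0 x00] : exists2 x, K0 x & x != 0.
  by apply: nontrivial K0n; split; exact: linear0.
have [y0 K1y0 y00] : exists2 y, K1 y & y != 0.
  by apply: nontrivial K1n; split; exact: linear0.
have [T TE] := rank_one_bop x0 y0.
have /nbhs_ballP[d /= d0 dU] := UX.
pose a : R[i] := d / (`|T| + 1).
have T1 : 0 < `|T| + 1 by rewrite ltr_wpDl.
have a0 : 0 < a by rewrite divr_gt0.
have : [set X] (X + a *: T).
  rewrite -UXE; split; last exact: riccati_perturbation Xsol K0x0 K1y0 TE.
  apply: dU; rewrite -ball_normE /ball_/= opprD addNKr normrN normrZ gtr0_norm//.
  by rewrite /a mulrAC ltr_pdivrMr// ltr_pM2l// ltrDl.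
move=> /= /eqP; rewrite -[eqbRHS]addr0 (inj_eq (addrI X)) scaler_eq0 gt_eqF//=.
move=> /eqP T0; have := TE x0; rewrite T0 => /esym/eqP.
rewrite scaler_eq0 (negbTE y00) orbF => /eqP /inner_eq0 /eqP.
by rewrite (negbTE x00).
Qed.

Hypothesis A0_le : forall x, '[A0 x, x] <= l%:C * '[x, x].
Hypothesis A1_ge : forall y, l%:C * '[y, y] <= '[A1 y, y].
Variable E : set R -> bop H H.
Hypothesis BE : is_spectral_measure B E.
Variable X : bop H0 H1.
Hypothesis XE : graph X = spectral_sum E l.

Let E_pvm : projection_valued_measure E := proj1 BE.
Let lt_set : set R := [set t | t < l].
Let gt_set : set R := [set t | l < t].
Let mlt : measurable lt_set.
Proof. by rewrite /lt_set -set_itvNyo; exact: measurable_itv. Qed.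
Let mgt : measurable gt_set.
Proof. by rewrite /gt_set -set_itvoy; exact: measurable_itv. Qed.
Let meq : measurable [set l]. Proof. exact: measurable_set1. Qed.

Definition proj_snd : bop H H := block_op (0 : bop H0 H0) (bop_id H1) 0 0.

(** The orthogonal projection onto the complement of [graph X]: the spectral
    subspace above [l], together with the part of the eigenspace of [l] that
    lies in [H1]. *)
Definition compl_proj : bop H H := E gt_set + proj_snd \ob E [set l].
Local Notation J := proj_snd.
Local Notation P := compl_proj.

Let JE u : J u = (0, u.2).
Proof. by apply: injective_projections; [exact: addr0|exact: add0r]. Qed.

Let PE u : P u = E gt_set u + J (E [set l] u). Proof. by []. Qed.

Let C_sa : selfadjoint C.
Proof.
apply: selfadjoint_shift; first by rewrite complex_real.
exact: block_op_sa.
Qed.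

Let decomp u : u = E lt_set u + E [set l] u + E gt_set u.
Proof.
rewrite {1}(pvm_setC E_pvm u mgt) addrC; congr (_ + _).
rewrite -(pvm_setU E_pvm)//.
  congr (E _ _); apply/seteqP; split=> t /=.
    by move/negP; rewrite -leNgt le_eqVlt => /orP[/eqP ->|]; [right|left].
  by case=> [/ltW h|->]; apply/negP; rewrite -leNgt.
by apply/seteqP; split => // t [h tl]; move: h; rewrite (tl : t = l) /lt_set /= ltxx.
Qed.

Let EE D D' u : measurable D -> measurable D' -> D `&` D' = set0 ->
  E D (E D' u) = 0.
Proof. exact: pvm_disjoint. Qed.

Let Eid D u : measurable D -> E D (E D u) = E D u.
Proof. by move=> mD; rewrite (pvm_comp E_pvm)// setIid. Qed.

Let lt_eq : lt_set `&` [set l] = set0.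
Proof.
apply/seteqP; split => // t [h tl]; move: h.
by rewrite (tl : t = l) /lt_set /= ltxx.
Qed.

Let gt_eq : gt_set `&` [set l] = set0.
Proof.
apply/seteqP; split => // t [h tl]; move: h.
by rewrite (tl : t = l) /gt_set /= ltxx.
Qed.

Let lt_gt : lt_set `&` gt_set = set0.
Proof.
by apply/seteqP; split => // t [/= h1 h2]; have := lt_trans h1 h2; rewrite ltxx.
Qed.

Let ker_components u : K0 (E [set l] u).1 /\ K1 (E [set l] u).2.
Proof.
apply/(ker_block_shift A0_sa A1_sa V_adj A0_le A1_ge).
exact: shift_set1_eq0.
Qed.

Let CJ u : C (J (E [set l] u)) = 0.
Proof.
apply/(ker_block_shift A0_sa A1_sa V_adj A0_le A1_ge); rewrite JE.
have [_ h] := ker_components u; split => //.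
by split; exact: linear0.
Qed.

Let EJ u : E [set l] (J (E [set l] u)) = J (E [set l] u).
Proof. exact: ker_shiftE (CJ u). Qed.

Let P_eq u : E [set l] (P u) = J (E [set l] u).
Proof.
by rewrite PE (bopD (E _)) EJ (EE _ meq mgt) ?add0r// setIC.
Qed.

Let P_gt u : E gt_set (P u) = E gt_set u.
Proof.
by rewrite PE (bopD (E _)) Eid// -EJ (EE _ mgt meq)// addr0.
Qed.

Let P_idem u : P (P u) = P u.
Proof. by rewrite [LHS]PE P_gt P_eq [RHS]PE; congr (_ + _); rewrite !JE. Qed.

Let CP u : C (P u) = C (E gt_set u).
Proof. by rewrite PE (bopD C) CJ addr0. Qed.

Let P_comm u : P (C u) = C (P u).
Proof.
rewrite CP PE (spectral_shift_comm BE)// -[E [set l] _](spectral_shift_comm BE)//.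
by rewrite (shift_set1_eq0 BE) (bop0 J) addr0.
Qed.

Let form_ker a k : C k = 0 -> '[C (a + k), a + k] = '[C a, a].
Proof.
move=> Ck; rewrite (bopD C) Ck addr0 innerDr.
by rewrite [X in _ + X]C_sa Ck linear0r addr0.
Qed.

Let P_ge0 u : 0 <= '[C (P u), P u].
Proof.
rewrite PE form_ker ?CJ//; apply: (form_above BE) => // t.
exact: ltW.
Qed.

Let QE u : u - P u = E lt_set u + (E [set l] u - J (E [set l] u)).
Proof.
by rewrite {1}(decomp u) PE opprD addrA addrK addrA.
Qed.

Let P_le0 u : '[C (u - P u), u - P u] <= 0.
Proof.
rewrite QE form_ker; last by rewrite (bopB C) CJ subr0 (shift_set1_eq0 BE).
by apply: (form_below BE) => // t; exact: ltW.
Qed.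

Lemma compl_proj_eq0P u : P u = 0 <-> graph X u.
Proof.
rewrite XE; split=> [Pu|[_ [p _ <-] [_ [[q _ <-] [x _ qE]] <-]]].
  have Ju : J (E [set l] u) = 0 by rewrite -P_eq Pu bop0.
  have := QE u; rewrite Pu Ju !subr0 => uE.
  exists (E lt_set u); first by exists u.
  exists (E [set l] u) => //; split; first by exists u.
  exists (E [set l] u).1 => //.
  by apply: injective_projections => //=; move: Ju; rewrite JE => -[].
rewrite PE (bopD (E gt_set)) (bopD (E [set l])) (EE _ mgt mlt) ?(setIC gt_set)//.
rewrite (EE _ mgt meq)// (EE _ meq mlt) ?(setIC [set l])// !add0r Eid//.
by rewrite JE -qE.
Qed.

Lemma isolated_of_ker_trivial : riccati_solutions A0 A1 V Vs X ->
  K0 = [set 0] \/ K1 = [set 0] -> isolated (riccati_solutions A0 A1 V Vs) X.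
Proof.
move=> Xsol Ktriv; split; first exact: mem_set.
have P1 : 0 < 2 * (`|P| + 1) by rewrite mulr_gt0// ltr_wpDl.
(* With this radius, [`|P u| <= 2^-1 * `|u|] on [graph Y]. *)
pose d : R[i] := (2 * (`|P| + 1))^-1.
have d0 : 0 < d by rewrite invr_gt0.
exists (ball X d); first exact: nbhsx_ballx.
apply/seteqP; split=> [Y [XY Ysol]|_ ->]; last by split => //; exact: ballxx.
have L_close u : graph Y u -> `|P u| <= `|u - P u|.
  move=> [x _ <-]; set u' : H := (x, Y x).
  have PX : P ((x, X x) : H) = 0 by apply/compl_proj_eq0P; exists x.
  have Pd : `|P| * d <= 2^-1.
    rewrite /d invfM mulrCA ler_piMr// ler_pdivrMr ?ltr_wpDl//.
    by rewrite mul1r lerDl.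
  have Pu' : `|P ((0, (Y - X) x) : H)| <= 2^-1 * `|u'|.
    apply: le_trans (ler_bop_norm _ _) _.
    apply: le_trans _ (ler_wpM2r (normr_ge0 _) Pd).
    rewrite -mulrA ler_wpM2l//.
    apply: le_trans (norm_hsum_le ((0, (Y - X) x) : H)) _; rewrite /= normr0 add0r.
    apply: le_trans (ler_bop_norm (Y - X) x) _; apply: ler_pM => //.
      by move: XY; rewrite -ball_normE /ball_/= distrC => /ltW.
    exact: (norm_fst_le u').
  have uP : P u' = P ((0, (Y - X) x) : H).
    rewrite -[LHS]subr0 -PX -(bopB P); congr (P _).
    by apply: injective_projections => //=; exact: subrr.
  move: Pu'; rewrite -uP ler_pdivlMl// => Pu'.
  have := ler_normD (P u') (u' - P u'); rewrite addrC subrK => /(le_trans Pu').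
  by rewrite mulr_natl mulr2n lerD2l.
have Psub : forall u, graph Y u -> P u = 0.
  have L_inv u a (Yu : graph Y u) := graph_block_inv l a Ysol Yu.
  case: Ktriv => Ktriv.
    apply: (subset_of_neg_injective C_sa P_idem P_comm P_ge0 P_le0 L_inv L_close).
    move=> u Cu; have := ker_shiftE BE Cu.
    rewrite bopB P_eq => <-.
    have : K0 (E [set l] u).1 by have [] := ker_components u.
    rewrite Ktriv => h.
    by apply: injective_projections; rewrite JE /= ?subr0 ?subrr.
  apply: (subset_of_pos_injective C_sa P_comm P_ge0 P_le0 L_inv L_close).
  move=> u Cu; have := ker_shiftE BE Cu.
  rewrite P_eq => <-; rewrite JE.
  have : K1 (E [set l] u).2 by have [] := ker_components u.
  by rewrite Ktriv => ->.
apply: bop_ext => x.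
have /Psub/compl_proj_eq0P[x' _ []] : graph Y ((x, Y x) : H) by exists x.
by move=> ->.
Qed.
End isolation.

Theorem corollary4p6 (R : realType) (H0 H1 : hilbertType R)
    (sepH : separable_space (hsum H0 H1))
    (A0 : bop H0 H0) (A1 : bop H1 H1) (V : bop H1 H0) (Vs : bop H0 H1)
    (A0_sa : selfadjoint A0) (A1_sa : selfadjoint A1)
    (V_adj : is_adjoint V Vs)
    (lambda : R)
    (supA0 : (ereal_sup [set (complex.Re z)%:E | z in spectrum A0]
              <= lambda%:E)%E)
    (infA1 : (lambda%:E
              <= ereal_inf [set (complex.Re z)%:E | z in spectrum A1])%E)
    (E : set R -> bop (hsum H0 H1) (hsum H0 H1))
    (E_spec : is_spectral_measure (block_op A0 A1 V Vs) E)
    (X : bop H0 H1)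
    (X_contr : `|X| <= 1)
    (X_sol : riccati_solutions A0 A1 V Vs X)
    (X_graph : graph X = spectral_sum E lambda) :
  isolated (riccati_solutions A0 A1 V Vs) X <->
  ker (A0 - lambda%:C *: bop_id H0) `&` ker Vs = [set 0] \/
  ker (A1 - lambda%:C *: bop_id H1) `&` ker V = [set 0].
Proof.
split; first exact: isolated_ker_trivial.
have A0_le := form_le_sup A0_sa supA0.
have A1_ge := inf_le_form A1_sa infA1.
exact: isolated_of_ker_trivial E_spec _ X_graph X_sol.
Qed.
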